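(* Define polynomials $\overline{P}_n(x)$ by $\overline{P}_0(x)=1$ and, for $n\ge1$, $\overline{P}_{n}(x)=\frac{x}{n}\sum_{k=1}^{n} \overline{\sigma}(k)\, \overline{P}_{n-k}(x)$, where for $n=2^m l$ with $l$ odd, $\overline{\sigma}(n)=2^{m+1}\sigma(l)$ with $\sigma(l)=\sum_{d\mid l}d$. Let $n$ be a positive integer and $x\in\mathbb{R}$ with $x\ge1$. Then \[\overline{P}_{n}(x)<\overline{P}_{n+1}(x) \quad\text{and}\quad 2 \le \overline{P}_{n}^{\prime}(x)<\overline{P}_{n+1}^{\prime}(x).\] Moreover, if $n+1=2^{s}$ with $s>1$, then there exists $x_{n}\in (0,1)$ such that $\overline{P}_{n+1}(x_{n})<\overline{P}_{n}(x_{n})$. *)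

(* Defs.v *)
From HB Require Import structures.
From mathcomp Require Import all_boot all_order all_algebra.
From mathcomp Require Import reals.

Set Implicit Arguments.
Unset Strict Implicit.
Unset Printing Implicit Defensive.

Import Order.TTheory GRing.Theory Num.Theory.

Local Open Scope ring_scope.

Definition sigma (n : nat) : nat := (\sum_(d <- divisors n) d)%N.

(* [n`_2^'] is the odd part of [n]; see [sigmabarE] for the defining rule. *)
Definition sigmabar (n : nat) : nat := (2 ^ (logn 2 n).+1 * sigma n`_2^')%N.

Lemma sigmabarE (m l : nat) : odd l ->
  sigmabar (2 ^ m * l) = (2 ^ m.+1 * sigma l)%N.
Proof.
move=> odd_l; have l_gt0 := odd_gt0 odd_l.
have m_gt0 : (0 < 2 ^ m)%N by rewrite expn_gt0.
have l2' : (2%N^').-nat l by rewrite p'natE // dvdn2 odd_l.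
rewrite /sigmabar lognM // pfactorK // (lognE 2 l) l_gt0 /= dvdn2 odd_l addn0.
by rewrite partnM // part_p'nat ?mul1n ?part_pnat_id // pnatNK pnatX pnat_id.
Qed.

(* [Pbar_seq R n] is the list of the first [n.+1] polynomials; the recursion
   refers to all previous terms, see [Pbar0] and [PbarE]. *)
Fixpoint Pbar_seq (R : numFieldType) (n : nat) : seq {poly R} :=
  if n is m.+1 then
    let s := Pbar_seq R m in
    rcons s ((m.+1%:R)^-1 *:
      ('X * \sum_(1 <= k < m.+2) (sigmabar k)%:R *: s`_(m.+1 - k)))
  else [:: 1].

Definition Pbar (R : numFieldType) (n : nat) : {poly R} := (Pbar_seq R n)`_n.

Lemma size_Pbar_seq (R : numFieldType) (n : nat) : size (Pbar_seq R n) = n.+1.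
Proof. by elim: n => //= n IHn; rewrite size_rcons IHn. Qed.

Lemma nth_Pbar_seq (R : numFieldType) (n i : nat) :
  (i <= n)%N -> (Pbar_seq R n)`_i = Pbar R i.
Proof.
elim: n => [|n IHn]; first by rewrite leqn0 => /eqP->.
rewrite leq_eqVlt => /predU1P[-> // | lt_in].
by rewrite /= nth_rcons size_Pbar_seq lt_in IHn.
Qed.

Lemma Pbar0 (R : numFieldType) : Pbar R 0 = 1.
Proof. by []. Qed.

Lemma PbarE (R : numFieldType) (n : nat) : (0 < n)%N ->
  Pbar R n = (n%:R)^-1 *:
    ('X * \sum_(1 <= k < n.+1) (sigmabar k)%:R *: Pbar R (n - k)).
Proof.
case: n => // n _.
rewrite {1}/Pbar /= nth_rcons size_Pbar_seq ltnn eqxx.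
congr (_ *: (_ * _)); apply: eq_big_nat => k /andP[k_gt0 _].
by rewrite nth_Pbar_seq // -ltnS ltn_subrL k_gt0.
Qed.

(* Main.v *)
Require Import Defs.
From HB Require Import structures.
From mathcomp Require Import all_boot all_order all_algebra.
From mathcomp Require Import reals.
From mathcomp Require Import lra.

Import Order.TTheory GRing.Theory Num.Theory.

Local Open Scope ring_scope.

(* The key is the sequence of differences [D_0 = P_0], [D_n = P_n - P_(n-1)]:
   with [F = \sum_n P_n(x) q^n], the recursion says that [q F' / F] is
   [x \sum_k sigmabar(k) q^k], so that [G = (1 - q) F] has
   [q G' / G = \sum_k (x sigmabar(k) - 1) q^k], that is
     [n D_n = \sum_(1 <= k <= n) (x sigmabar(k) - 1) D_(n-k)].
   As [sigmabar(k) >= 2], all these weights are positive when [x >= 1], hence so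
   are the [D_n]; differentiating in [x] gives the same for the [D_n'].
   For the last claim, [P_n(x) / x] takes the value [sigmabar(n) / n] at [0],
   which is [2] when [n] is a power of [2] and exceeds [2] when [n > 1] is odd. *)

Lemma sigma_gt0 (n : nat) : (0 < n)%N -> (0 < sigma n)%N.
Proof.
move=> n_gt0; rewrite /sigma (big_rem n) /= ?addn_gt0 ?n_gt0 //.
by rewrite -dvdn_divisors.
Qed.

Lemma sigma1 : sigma 1 = 1%N.
Proof. by rewrite /sigma big_seq1. Qed.

(** The divisors [1] and [n] are distinct and already contribute [n + 1]. *)
Lemma ltn_sigma (n : nat) : (1 < n)%N -> (n < sigma n)%N.
Proof.
move=> n_gt1; have n_gt0 := ltnW n_gt1.
rewrite /sigma (big_rem n) /=; last by rewrite -dvdn_divisors.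
rewrite (big_rem 1%N) /=; first by rewrite -addn1 leq_add2l leq_addr.
by rewrite mem_rem_uniq ?divisors_uniq // !inE neq_ltn n_gt1 -dvdn_divisors
  ?dvd1n.
Qed.

Lemma sigmabar_ge2 (n : nat) : (2 <= sigmabar n)%N.
Proof.
rewrite /sigmabar expnS -mulnA -{1}[2%N]muln1 leq_pmul2l //.
by rewrite muln_gt0 expn_gt0 sigma_gt0 // part_gt0.
Qed.

Lemma sigmabar_exp2 (s : nat) : sigmabar (2 ^ s) = (2 ^ s.+1)%N.
Proof. by have := sigmabarE s (isT : odd 1); rewrite sigma1 !muln1. Qed.

Lemma sigmabar_odd (n : nat) : odd n -> sigmabar n = (2 * sigma n)%N.
Proof. by move=> /(sigmabarE 0); rewrite mul1n. Qed.

Section Differences.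

Variable R : numFieldType.

Lemma Pbar_rec (n : nat) :
  n.+1%:R *: Pbar R n.+1 =
  'X * \sum_(k < n.+1) (sigmabar k.+1)%:R *: Pbar R (n - k).
Proof.
by rewrite PbarE // scalerA divff ?pnatr_eq0 // scale1r big_add1 big_mkord.
Qed.

Definition Pdiff (n : nat) : {poly R} :=
  if n is m.+1 then Pbar R m.+1 - Pbar R m else Pbar R 0.

Lemma sum_Pdiff (n : nat) : \sum_(k < n.+1) Pdiff (n - k) = Pbar R n.
Proof.
elim: n => [|n IHn]; first by rewrite big_ord1.
rewrite big_ord_recl subn0 /=; under eq_bigr do rewrite subSS.
by rewrite IHn subrK.
Qed.

(** Subtracting the recursion at [n] from that at [n.+1] leaves [n.+1 D_(n+1) + P_n] on the left;
    the extra [P_n] is the sum of all [D_(n-k)], whence the [- 1] in each weight. *)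
Lemma Pdiff_rec (n : nat) :
  n.+1%:R *: Pdiff n.+1 =
  \sum_(k < n.+1) ((sigmabar k.+1)%:R *: 'X - 1) * Pdiff (n - k).
Proof.
under eq_bigr do rewrite mulrBl mul1r -scalerAl scalerAr.
rewrite sumrB -mulr_sumr sum_Pdiff /= scalerBr Pbar_rec.
case: n => [|n]; first by rewrite !big_ord1 scale1r.
rewrite -(natr1 n.+1) scalerDl scale1r Pbar_rec opprD addrA -mulrBr.
(* The last term, with [D_0 = P_0], is split off because it is not a difference. *)
congr (_ * _ - _); rewrite !(big_ord_recr n.+1) /= subnn addrAC -sumrB.
congr (_ + _); apply: eq_bigr => k _.
by rewrite -scalerBr subSn // -ltnS.
Qed.

Lemma Pdiff_deriv_rec (n : nat) :
  n.+1%:R *: (Pdiff n.+1)^`() =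
  \sum_(k < n.+1) ((sigmabar k.+1)%:R *: Pdiff (n - k) +
    ((sigmabar k.+1)%:R *: 'X - 1) * (Pdiff (n - k))^`()).
Proof.
rewrite -derivZ Pdiff_rec raddf_sum; apply: eq_bigr => k _ /=.
by rewrite derivM derivB derivZ derivX derivC subr0 -scalerAl mul1r.
Qed.

End Differences.

Lemma sum_ord_gt0 (R : numDomainType) (n : nat) (F : 'I_n.+1 -> R) :
  (forall k, 0 < F k) -> 0 < \sum_(k < n.+1) F k.
Proof.
move=> F_gt0; rewrite big_ord_recl ltr_pwDl // sumr_ge0 // => k _.
exact: ltW.
Qed.

Section Positivity.

Variables (R : realFieldType) (x : R).
Hypothesis x_ge1 : 1 <= x.

Lemma weight_gt0 (k : nat) : 0 < (sigmabar k)%:R * x - 1.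
Proof.
have : 2 <= (sigmabar k)%:R :> R by rewrite ler_nat sigmabar_ge2.
rewrite subr_gt0 => c_ge2; apply: lt_le_trans (ler_peMr _ x_ge1); lra.
Qed.

Lemma Pdiff_gt0 (n : nat) : 0 < (Pdiff R n).[x].
Proof.
elim/ltn_ind: n => -[_|n IHn]; first by rewrite /= Pbar0 hornerC.
have n1_gt0 : 0 < n.+1%:R :> R by rewrite ltr0n.
rewrite -(pmulr_rgt0 _ n1_gt0) -hornerZ Pdiff_rec horner_sum.
apply: sum_ord_gt0 => k; rewrite hornerM !hornerE mulr_gt0 ?weight_gt0 //.
by rewrite IHn // ltnS leq_subr.
Qed.

(** The index starts at [1] because [D_0' = 0]. Strictness comes from the terms
    [sigmabar(k) D_(n-k)]; those with derivatives need only be nonnegative. *)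
Lemma Pdiff_deriv_gt0 (n : nat) : 0 < (Pdiff R n.+1)^`().[x].
Proof.
elim/ltn_ind: n => n IHn.
have deriv_ge0 k : 0 <= (Pdiff R (n - k))^`().[x].
  case def_m: (n - k)%N => [|m]; first by rewrite /= derivC hornerC.
  by rewrite ltW // IHn // -def_m leq_subr.
have n1_gt0 : 0 < n.+1%:R :> R by rewrite ltr0n.
rewrite -(pmulr_rgt0 _ n1_gt0) -hornerZ Pdiff_deriv_rec horner_sum.
apply: sum_ord_gt0 => k; rewrite hornerD hornerZ hornerM !hornerE ltr_pwDl //.
  by rewrite mulr_gt0 ?Pdiff_gt0 // ltr0n (leq_trans _ (sigmabar_ge2 _)).
by rewrite mulr_ge0 // ltW // weight_gt0.
Qed.

Lemma Pbar_ltS (n : nat) : (Pbar R n).[x] < (Pbar R n.+1).[x].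
Proof. by have := Pdiff_gt0 n.+1; rewrite /= hornerD hornerN subr_gt0. Qed.

Lemma Pbar_deriv_ltS (n : nat) : (Pbar R n)^`().[x] < (Pbar R n.+1)^`().[x].
Proof.
by have := Pdiff_deriv_gt0 n; rewrite /= derivB hornerD hornerN subr_gt0.
Qed.

Lemma Pbar_deriv_ge2 (n : nat) : 2 <= (Pbar R n.+1)^`().[x].
Proof.
elim: n => [|n IHn]; last exact: le_trans IHn (ltW (Pbar_deriv_ltS _)).
(* Base case: [P_1 = 2 X], as [sigmabar 1 = 2]. *)
have := Pbar_rec R 0; rewrite big_ord1 scale1r Pbar0 -[1%N]/(2 ^ 0)%N.
rewrite sigmabar_exp2 => ->.
by rewrite -scalerAr mulr1 derivZ derivX hornerZ hornerC mulr1.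
Qed.

End Positivity.

(** Explicit continuity at [0]: write [p = p(0) + X t] and bound [t] by [b] on [[0, 1]], so that
    [p(y) <= p(0) + b y] there. *)
Lemma horner_lt0_near0 (R : realFieldType) (p : {poly R}) :
  p.[0] < 0 -> exists y : R, 0 < y < 1 /\ p.[y] < 0.
Proof.
move=> p0_lt0.
have /factor_theorem[t def_t] : root (p - p.[0]%:P) 0.
  by rewrite /root !hornerE subrr.
have [b ub_t] := poly_itv_bound t 0 1.
have b_ge0 : 0 <= b by apply: le_trans (ub_t 0 _); rewrite // lexx ler01.
have d_gt0 : 0 < 1 + b - p.[0] by lra.
(* This choice of [y] gives [p(0) + b y = y p(0) - y < 0]. *)
have [y def_y] : {y | y * (1 + b - p.[0]) = - p.[0]}.
  by exists (- p.[0] / (1 + b - p.[0])); rewrite divfK // gt_eqF.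
have y_gt0 : 0 < y by rewrite -(pmulr_lgt0 _ d_gt0) def_y oppr_gt0.
have y_lt1 : y < 1 by rewrite -(ltr_pM2r d_gt0) def_y; lra.
exists y; split; first by rewrite y_gt0.
have le_tb : t.[y] <= b.
  by apply: le_trans (ler_norm _) (ub_t _ _); rewrite (ltW y_gt0) ltW.
have /eqP : (p - p.[0]%:P).[y] = t.[y] * y.
  by rewrite def_t hornerM hornerD hornerN hornerX hornerC subr0.
rewrite hornerD hornerN hornerC subr_eq => /eqP ->.
have : t.[y] * y <= b * y by rewrite ler_pM2r.
have : y * p.[0] < 0 by rewrite pmulr_rlt0.
by lra.
Qed.

Theorem theorem1p6 (R : realType) (n : nat) (hn : (0 < n)%N) :
  (forall x : R, 1 <= x ->
     (Pbar R n).[x] < (Pbar R n.+1).[x] /\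
     2 <= (Pbar R n)^`().[x] < (Pbar R n.+1)^`().[x]) /\
  (forall s : nat, (1 < s)%N -> n.+1 = (2 ^ s)%N ->
     exists y : R, 0 < y < 1 /\ (Pbar R n.+1).[y] < (Pbar R n).[y]).
Proof.
case: n hn => // n _; split=> [x x_ge1|s s_gt1 def_n].
  by split; [exact: Pbar_ltS | rewrite Pbar_deriv_ge2 ?Pbar_deriv_ltS].
have odd_n : odd n.+1 by rewrite -[odd _]negbK -oddS def_n oddX orbF -lt0n ltnW.
have n_gt1 : (1 < n.+1)%N.
  have : (2 ^ 2 <= n.+2)%N by rewrite def_n leq_exp2l.
  exact: ltnW.
(* [q m] is [P_(m+1) / X]. At [0] only its term with [P_0] survives, the other [P_j] being multiples
   of [X]. *)
pose q m := m.+1%:R^-1 *: \sum_(k < m.+1) (sigmabar k.+1)%:R *: Pbar R (m - k).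
have PbarXq m : Pbar R m.+1 = 'X * q m.
  apply: (@scalerI _ _ m.+1%:R); first by rewrite pnatr_eq0.
  by rewrite Pbar_rec -scalerAr scalerA divff ?pnatr_eq0 // scale1r.
have q0 m : (q m).[0] = (sigmabar m.+1)%:R / m.+1%:R.
  rewrite hornerZ horner_sum big_ord_recr /= subnn Pbar0 big1 ?add0r => [|k _].
    by rewrite hornerZ hornerC mulr1 mulrC.
  by rewrite hornerZ -(subnSK (ltn_ord k)) PbarXq hornerM hornerX mul0r mulr0.
have [|y [y01]] := @horner_lt0_near0 _ (q n.+1 - q n).
  (* At [0] this compares [2] with [2 sigma(n+1) / (n+1)]. *)
  rewrite hornerD hornerN subr_lt0 !q0 (sigmabar_odd _ odd_n) def_n.
  rewrite sigmabar_exp2 expnS natrM mulfK.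
    rewrite natrM ltr_pdivlMr ?ltr0n // ltr_pM2l ?ltr0n //.
    by rewrite ltr_nat ltn_sigma.
  by rewrite pnatr_eq0 -lt0n expn_gt0.
rewrite hornerD hornerN subr_lt0 => lt_q.
exists y; split=> //; rewrite !PbarXq !hornerM hornerX ltr_pM2l //.
by case/andP: y01.
Qed.
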